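(* There is an algorithm solving the $(\epsilon,\delta)$-winner determination problem for the approval voting rule with sample complexity $O\!\left(\frac{\log(m/\delta)}{\epsilon^2}\right)$.
   Context: In approval voting with $n$ voters and $m$ candidates, each voter approves a subset of candidates, and the candidate approved by the most voters wins (ties broken by an arbitrary fixed rule). The margin of victory (MOV) is the smallest number of votes that must be changed (others kept unchanged) to change the winner. The $(\epsilon,\delta)$-winner determination problem: given the $n$ votes with MOV at least $\epsilon n$, output the winner with probability at least $1-\delta$ over the algorithm's internal randomness; the algorithm may query full votes of arbitrary voters, and the sample complexity is the number of queried votes. *)

(* Defs.v *)
From HB Require Import structures.
From mathcomp Require Import all_boot all_order all_algebra.
From mathcomp Require Import all_classical all_reals all_analysis.

Set Implicit Arguments.
Unset Strict Implicit.
Unset Printing Implicit Defensive.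

Import Order.TTheory GRing.Theory Num.Theory.
Local Open Scope ring_scope.

Definition vote (m : nat) := {set 'I_m}.

Definition profile (n m : nat) := {ffun 'I_n -> vote m}.

Definition score n m (P : profile n m) (c : 'I_m) : nat :=
  #|[set i : 'I_n | c \in P i]|.

(* The approval rule together with a tie-breaking rule, seen as the resulting
   resolute map from profiles to winners.  Tie-breaking is unconstrained: the
   choice among the tied candidates may depend on the whole profile.  Such a
   map exists only if there is at least one candidate, i.e. 0 < m. *)
Definition approval_rule n m (w : profile n m -> 'I_m) : Prop :=
  forall (P : profile n m) (c : 'I_m), (score P c <= score P (w P))%N.

Definition changed_votes n m (P Q : profile n m) : nat :=
  #|[set i : 'I_n | P i != Q i]|.

(* The value is +oo when no change of votes alters the winner (for an approval
   rule, this happens only if m = 1 or n = 0). *)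
Definition margin_of_victory (R : realType) n m (w : profile n m -> 'I_m)
    (P : profile n m) : \bar R :=
  \big[Order.min/+oo%E]_(Q : profile n m | w Q != w P)
    ((changed_votes P Q)%:R)%:E.

(* Randomized adaptive query algorithms: Query i k asks for the full vote of
   voter i and continues according to the answer; Toss s k draws a uniformly
   distributed element of {0, ..., s} and continues according to it. *)
Inductive algorithm (n m : nat) : Type :=
  | Output of 'I_m
  | Query of 'I_n & (vote m -> algorithm n m)
  | Toss (s : nat) of ('I_s.+1 -> algorithm n m).

Fixpoint output_prob (R : realType) n m (A : algorithm n m) (P : profile n m)
    (c : 'I_m) : R :=
  match A with
  | Output d => (d == c)%:R
  | Query i k => output_prob R (k (P i)) P c
  | Toss s k => (s.+1%:R)^-1 * \sum_(j < s.+1) output_prob R (k j) P c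
  end.

(* Worst case over the internal randomness; a voter queried twice is counted
   twice. *)
Fixpoint num_queries n m (A : algorithm n m) (P : profile n m) : nat :=
  match A with
  | Output _ => 0%N
  | Query i k => (num_queries (k (P i)) P).+1
  | Toss s k => \max_(j < s.+1) num_queries (k j) P
  end.

Definition solves_winner_determination (R : realType) n m
    (w : profile n m -> 'I_m) (eps delta : R) (A : algorithm n m) : Prop :=
  forall P : profile n m,
    ((eps * n%:R)%:E <= margin_of_victory R w P)%E ->
    1 - delta <= output_prob R A P (w P).

(* Main.v *)
(* If x <= MOV and x > 1, the winner leads every rival by at least x votes:
   turning g votes that approve the winner but not the rival into votes for the
   rival alone closes a lead g > 0, and one changed vote breaks a tie.  Sample k
   voters with replacement and output the approval winner of the sample.
   Writing t = eps / 4, each rival c carries the potential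
     (1 - t) ^ (#approvals of the winner - #approvals of c),
   which is at least 1 when c beats the winner in the sample and which shrinks
   in mean by the factor 1 - t eps + 2 t^2 = 1 - eps^2 / 8 at each draw.  Hence
   the failure probability is at most m (1 - eps^2 / 8)^k <= delta once
   k >= 8 ln (m / delta) / eps^2.  When eps n <= 1 the profile may be tied, and
   no amount of sampling helps, but then n <= 1 / eps and all votes can be
   queried. *)
Require Import Defs.
From HB Require Import structures.
From mathcomp Require Import all_boot all_order all_algebra.
From mathcomp Require Import all_classical all_reals all_analysis.
From mathcomp Require Import ring lra zify.

Set Implicit Arguments.
Unset Strict Implicit.
Unset Printing Implicit Defensive.

Import Order.TTheory GRing.Theory Num.Theory.
Local Open Scope ring_scope.

(** * From the margin of victory to score gaps *)

Lemma changed_votes_ge (R : realType) n m (w : profile n m -> 'I_m)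
    (P Q : profile n m) (x : R) :
  (x%:E <= margin_of_victory R w P)%E -> w Q != w P ->
  x <= (changed_votes P Q)%:R.
Proof.
move=> xP wQ; rewrite -lee_fin; apply: (le_trans xP).
exact: (@bigmin_le_cond _ _ _ +oo%E Q
  (fun Q : profile n m => w Q != w P) (fun Q => (changed_votes P Q)%:R%:E)).
Qed.

(** The change on [S] most favourable to [c]: each ballot gives [c] a point and takes from every
    rival any point it had there. *)
Definition single_out n m (P : profile n m) (S : {set 'I_n}) (c : 'I_m) :
    profile n m :=
  [ffun i => if i \in S then [set c] else P i].

Lemma changed_single_out n m (P : profile n m) S c :
  (changed_votes P (single_out P S c) <= #|S|)%N.
Proof.
apply: subset_leq_card; apply/fintype.subsetP => i; rewrite inE ffunE.
by case: ifP => //; rewrite eqxx.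
Qed.

Lemma score_single_out n m (P : profile n m) S c :
  score (single_out P S c) c =
    (score P c + #|S :\: [set i | c \in P i]|)%N.
Proof.
rewrite /score [RHS]addnC -[X in (_ + X)%N](cardsID S).
rewrite [X in (_ + X)%N]addnC addnCA.
rewrite (_ : (_ + #|_ :&: S|)%N = #|S|); last first.
  by rewrite -[RHS](cardsID [set i | c \in P i]) addnC finset.setIC.
rewrite -[LHS](cardsID S) addnC; congr addn; apply: eq_card => i;
  rewrite !inE !ffunE; case: ifP => //=; rewrite ?finset.set11 ?andbF //.
Qed.

Lemma score_single_out_neq n m (P : profile n m) S c d : d != c ->
  (score (single_out P S c) d + #|S :&: [set i | d \in P i]| = score P d)%N.
Proof.
move=> dc; rewrite /score -[RHS](cardsID S) addnC finset.setIC; congr addn.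
apply: eq_card => i; rewrite !inE !ffunE; case: ifP => //=.
by rewrite finset.in_set1 (negbTE dc).
Qed.

(** The strict inequality makes [c] overtake [w P] in [single_out P S c], so the winner changes
    under any tie-breaking. *)
Lemma card_ge_single_out (R : realType) n m (w : profile n m -> 'I_m)
    (P : profile n m) (x : R) (S : {set 'I_n}) (c : 'I_m) :
  approval_rule w -> (x%:E <= margin_of_victory R w P)%E -> c != w P ->
  (score P (w P) < score P c + #|S :\: [set i | c \in P i]|
                   + #|S :&: [set i | w P \in P i]|)%N ->
  x <= #|S|%:R.
Proof.
move=> wR xP cw ltS; have wc : w P != c by rewrite eq_sym.
have wQ : w (single_out P S c) != w P.
  apply/eqP => wQ; have := wR (single_out P S c) c.
  rewrite wQ score_single_out -(leq_add2r #|S :&: [set i | w P \in P i]|).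
  by rewrite (score_single_out_neq _ _ wc) leqNgt ltS.
by apply: le_trans (changed_votes_ge xP wQ) _; rewrite ler_nat changed_single_out.
Qed.

Lemma score_gap (R : realType) n m (w : profile n m -> 'I_m)
    (P : profile n m) (x : R) (c : 'I_m) :
  approval_rule w -> (x%:E <= margin_of_victory R w P)%E -> 1 < x ->
  (0 < n)%N -> c != w P ->
  (score P c)%:R + x <= (score P (w P))%:R.
Proof.
move=> wR xP x1 n0 cw.
set W := [set i | w P \in P i]; set D := [set i | c \in P i].
have le_cw : (score P c <= score P (w P))%N by apply: wR.
have [lt_cw|ge_cw] := ltnP (score P c) (score P (w P)).
  have : (score P (w P) - score P c <= #|W :\: D|)%N.
    rewrite leq_subLR /score -/W -/D -(cardsID D W) leq_add2r.
    exact/subset_leq_card/finset.subsetIr.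
  (* [s] has exactly as many voters as the lead; each one shifts the difference by two, so [c]
     overtakes strictly. *)
  move=> /card_geqP[s [s_uniq s_size s_sub]].
  have sWD i : i \in s -> (w P \in P i) && (c \notin P i).
    by move=> /s_sub; rewrite !inE andbC.
  pose S := [set i in s].
  have SD : S :\: D = S.
    apply/setP => i; rewrite !inE.
    by case: (boolP (i \in s)) => [/sWD/andP[_ ->]|]; rewrite ?andbF.
  have SW : S :&: W = S.
    apply/setP => i; rewrite !inE.
    by case: (boolP (i \in s)) => [/sWD/andP[->]|].
  have cardS : #|S| = (score P (w P) - score P c)%N.
    by rewrite cardsE (card_uniqP s_uniq).
  have : x <= #|S|%:R.
    apply: (card_ge_single_out wR xP cw); rewrite SD SW cardS subnKC //.
    by rewrite -[ltnLHS]addn0 ltn_add2l subn_gt0.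
  by rewrite cardS natrB // lerBrDl.
have score_eq : score P c = score P (w P) by apply/eqP; rewrite eqn_leq le_cw.
(* In a tie, one such voter can tip the result, contradicting [1 < x]. *)
suff [i Hi] : exists i, (c \notin P i) || (w P \in P i).
  have : x <= #|[set i]|%:R.
    apply: (card_ge_single_out wR xP cw).
    rewrite score_eq -addnA -[ltnLHS]addn0 ltn_add2l addn_gt0 !card_gt0.
    case/orP: Hi => Hi; apply/orP; [left|right]; apply/finset.set0Pn; exists i;
      by rewrite !inE eqxx ?Hi.
  by rewrite cards1 leNgt x1.
have [/eqP W0|/finset.set0Pn[i]] := boolP (W == finset.set0); last first.
  by rewrite inE => Hi; exists i; rewrite Hi orbT.
(* Nobody approves [w P], so the tied [c] has no approval either and any voter serves. *)
exists (Ordinal n0); apply/orP; left; apply/negP => cP.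
have /eqP : score P c = 0%N by rewrite score_eq /score -/W W0 cards0.
by rewrite cards_eq0 => /eqP/setP/(_ (Ordinal n0)); rewrite !inE cP.
Qed.

(** * The two query algorithms *)

Section Algorithms.
Variables n m : nat.

(** [Q] records the answers so far; its values at voters still in [s] are placeholders. *)
Fixpoint query_all (w : profile n m -> 'I_m) (s : seq 'I_n)
    (Q : profile n m) : algorithm n m :=
  match s with
  | [::] => Output n (w Q)
  | i :: s' =>
    Query i (fun v => query_all w s' [ffun j => if j == i then v else Q j])
  end.

Lemma output_prob_query_all (R : realType) w s (P Q : profile n m) c :
  (forall i, i \notin s -> Q i = P i) ->
  output_prob R (query_all w s Q) P c = (w P == c)%:R.
Proof.
elim: s Q => [|i s IHs] Q QP /=.
  by congr (w _ == _)%:R; apply/ffunP => i; apply: QP.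
apply: IHs => j js; rewrite ffunE; case: eqVneq => [->//|ji].
by apply: QP; rewrite inE negb_or ji.
Qed.

Lemma num_queries_query_all w s (P Q : profile n m) :
  num_queries (query_all w s Q) P = size s.
Proof. by elim: s Q => //= i s IHs Q; rewrite IHs. Qed.

Definition approvals (s : seq (vote m)) (c : 'I_m) : nat :=
  count (fun v : vote m => c \in v) s.

(** [s] collects the drawn votes; [c0] is the starting candidate that arg max requires. *)
Fixpoint sampling (c0 : 'I_m) (k : nat) (s : seq (vote m)) :
    algorithm n.+1 m :=
  match k with
  | 0 => Output _ [arg max_(c > c0) approvals s c]
  | k'.+1 => Toss (fun j => Query j (fun v => sampling c0 k' (v :: s)))
  end.

Lemma num_queries_sampling c0 k s P :
  (num_queries (sampling c0 k s) P <= k)%N.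
Proof. by elim: k s => //= k IHk s; apply/bigmax_leqP => j _; apply: IHk. Qed.

End Algorithms.

(** * Potential argument for sampling *)

Lemma draw_factor_le (R : realType) (t : R) (a b : bool) :
  0 <= t <= 1 / 2 ->
  (1 - t) ^+ a * (1 - t)^-1 ^+ b <= 1 - t * (a%:R - b%:R) + 2 * t ^+ 2.
Proof.
move=> /andP[t0 t1]; have y0 : 0 < 1 - t by lra.
case: a; case: b; rewrite ?expr1 ?expr0 ?mul1r ?mulr1 ?divff ?gt_eqF //=; try nra.
(* Only a vote for the rival alone remains: [(1 + t + 2 t^2) (1 - t) = 1 + t^2 (1 - 2 t)], at least
   1 as [t <= 1/2]. *)
rewrite -div1r ler_pdivrMr //; nra.
Qed.

Section SamplingCorrect.
Variables (R : realType) (n m : nat) (P : profile n.+1 m) (d : 'I_m) (t : R).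
Hypothesis t_bound : 0 <= t <= 1 / 2.

Let y := 1 - t.

Definition potential (s : seq (vote m)) (c : 'I_m) : R :=
  y ^+ approvals s d * y^-1 ^+ approvals s c.

Let y_gt0 : 0 < y. Proof. by rewrite /y; have := t_bound; lra. Qed.

Lemma potential_ge0 s c : 0 <= potential s c.
Proof. by rewrite mulr_ge0 // exprn_ge0 // ?invr_ge0 ltW. Qed.

Lemma potential_ge1 s c :
  (approvals s d <= approvals s c)%N -> 1 <= potential s c.
Proof.
move=> le_dc; rewrite /potential exprVn ler_pdivlMr ?exprn_gt0 // mul1r.
by apply: ler_wiXn2l => //; [exact: ltW|rewrite /y; have := t_bound; lra].
Qed.

Lemma potential_cons v s c :
  potential (v :: s) c =
  potential s c * (y ^+ (d \in v) * y^-1 ^+ (c \in v)).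
Proof. by rewrite /potential /= !exprD; ring. Qed.

Lemma sum_scoreE (c : 'I_m) :
  \sum_(i < n.+1) (c \in P i)%:R = (score P c)%:R :> R.
Proof.
rewrite -natr_sum -big_mkcond sum1_card /score; congr _%:R.
by apply: eq_card => i; rewrite !inE.
Qed.

(** The bound on each voter's factor is linear in the two approvals, so averaging it leaves the
    score gap divided by [n.+1], at least [x]. *)
Lemma mean_potential_le (x : R) s c :
  (score P c)%:R + x * n.+1%:R <= (score P d)%:R ->
  n.+1%:R^-1 * \sum_(j < n.+1) potential (P j :: s) c <=
  (1 - t * x + 2 * t ^+ 2) * potential s c.
Proof.
move=> gap.
under eq_bigr do rewrite potential_cons.
rewrite -mulr_sumr mulrCA [leRHS]mulrC ler_wpM2l ?potential_ge0 //.
rewrite mulrC ler_pdivrMr ?ltr0n //.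
apply: le_trans (ler_sum _ (fun i _ => draw_factor_le _ _ t_bound)) _.
rewrite !big_split /= sumrN -mulr_sumr sumrB !sum_scoreE !sumr_const card_ord.
rewrite -mulr_natr; have /andP[t0 _] := t_bound.
have := ler_wpM2l t0 gap; lra.
Qed.

(** Induction on the remaining draws, for all past samples [s]. At the end a wrong output has
    potential at least 1; the sum over rivals acts as a union bound, and each draw contracts every
    term in mean by [r]. *)
Lemma sampling_failure_le c0 (r : R) k s :
  0 <= r ->
  (forall s c, c != d ->
    n.+1%:R^-1 * \sum_(j < n.+1) potential (P j :: s) c <= r * potential s c) ->
  1 - output_prob R (sampling n c0 k s) P d <=
  r ^+ k * \sum_(c | c != d) potential s c.
Proof.
move=> r0 Hr; elim: k s => [|k IHk] s /=.
  rewrite expr0 mul1r; case: arg_maxnP => // c _ max_c.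
  have [_|cd] := eqVneq c d.
    by rewrite subrr sumr_ge0 // => c' _; rewrite potential_ge0.
  rewrite subr0 (bigD1 c) //= (le_trans (potential_ge1 (max_c d isT))) //.
  by rewrite lerDl sumr_ge0 // => c' _; rewrite potential_ge0.
have n0 : 0 < n.+1%:R :> R by rewrite ltr0n.
have -> : 1 - n.+1%:R^-1 * \sum_(j < n.+1)
    output_prob R (sampling n c0 k (P j :: s)) P d =
  n.+1%:R^-1 * \sum_(j < n.+1)
    (1 - output_prob R (sampling n c0 k (P j :: s)) P d).
  rewrite sumrB sumr_const card_ord mulrBr -[1 *+ _]/(n.+1%:R).
  by rewrite mulVf // gt_eqF.
apply: (@le_trans _ _ (n.+1%:R^-1 * \sum_(j < n.+1)
    r ^+ k * \sum_(c | c != d) potential (P j :: s) c)).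
  by rewrite ler_wpM2l ?invr_ge0 ?ler0n // ler_sum.
rewrite -mulr_sumr mulrCA exprSr -mulrA ler_wpM2l ?exprn_ge0 //.
by rewrite exchange_big /= !mulr_sumr ler_sum // => c cd; apply: Hr.
Qed.

End SamplingCorrect.

(** * Parameter bounds and sample size *)

Lemma ln_ge_half (R : realType) (x : R) : 2 <= x -> 1 / 2 <= ln x.
Proof.
move=> x2; have x0 : 0 < x by lra.
(* This gives [ln x >= 1 - 1/x]. *)
have := expR_ge1Dx (- ln x).
rewrite expRN lnK ?posrE // => h.
have : x^-1 <= 2^-1 by rewrite lef_pV2 ?posrE.
lra.
Qed.

Definition empty_profile n m : profile n m := [ffun=> finset.set0].

(** Making all voters approve one rival alone changes the winner. Hence the promise is void when
    [eps > 1]. *)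
Lemma margin_of_victory_le (R : realType) n m (w : profile n m -> 'I_m)
    (P : profile n m) (x : R) :
  approval_rule w -> (x%:E <= margin_of_victory R w P)%E ->
  (0 < n)%N -> (1 < m)%N -> x <= n%:R.
Proof.
move=> wR xP n0 m1.
have [c cw] : exists c, c != w P.
  case: m m1 w P wR xP => [//|[//|m]] _ w P _ _.
  by have [->|?] := eqVneq (w P) ord0; [exists ord_max|exists ord0; rewrite eq_sym].
have := card_ge_single_out (S := [set: 'I_n]%SET) wR xP cw.
rewrite cardsT card_ord; apply.
rewrite finset.setTD finset.setTI /score cardsC card_ord.
by rewrite -[ltnLHS]add0n ltn_add2r.
Qed.

(** Keeps the query bound away from 0, leaving room for rounding and for full querying. *)
Lemma ln_ratio_ge_half (R : realType) (m : nat) (delta : R) :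
  (1 < m)%N -> 0 < delta -> delta < 1 -> 1 / 2 <= ln (m%:R / delta).
Proof.
move=> m1 d0 d1; apply: ln_ge_half; rewrite ler_pdivlMr //.
have : 2 <= m%:R :> R by rewrite ler_nat.
nra.
Qed.

Lemma sampling_solves (R : realType) n m (w : profile n.+1 m -> 'I_m)
    (P : profile n.+1 m) (eps delta : R) c0 k :
  approval_rule w -> ((eps * n.+1%:R)%:E <= margin_of_victory R w P)%E ->
  0 < eps <= 1 -> 1 < eps * n.+1%:R -> (1 < m)%N -> 0 < delta ->
  8 * (ln (m%:R / delta) / eps ^+ 2) <= k%:R ->
  1 - delta <= output_prob R (sampling n c0 k [::]) P (w P).
Proof.
move=> wR epsP /andP[e0 e1] en m1 d0 hk.
have md0 : 0 < m%:R / delta by rewrite divr_gt0 // ltr0n ltnW.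
(* [t = eps / 4] minimises [1 - t eps + 2 t^2], with value [r]. *)
have t_bound : 0 <= eps / 4 <= 1 / 2 by lra.
set r := 1 - eps ^+ 2 / 8.
have r0 : 0 <= r by rewrite /r; nra.
have Hr s c : c != w P -> n.+1%:R^-1 * \sum_(j < n.+1)
    potential (w P) (eps / 4) (P j :: s) c <= r * potential (w P) (eps / 4) s c.
  move=> cw.
  have := mean_potential_le t_bound s (score_gap wR epsP en (ltn0Sn n) cw).
  by congr (_ <= _ * _); rewrite /r; field.
have := sampling_failure_le t_bound c0 k [::] r0 Hr.
suff : r ^+ k * \sum_(c | c != w P) potential (w P) (eps / 4) [::] c <= delta.
  lra.
apply: (@le_trans _ _ (r ^+ k * m%:R)).
  rewrite ler_wpM2l ?exprn_ge0 //.
  under eq_bigr do rewrite /potential /= !expr0 mulr1.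
  rewrite sumr_const -[leLHS]/(_%:R) ler_nat.
  by rewrite -[leqRHS]card_ord max_card.
have r_exp : r ^+ k <= delta / m%:R.
  have -> : delta / m%:R = expR (- ln (m%:R / delta)).
    by rewrite expRN lnK ?posrE // invf_div.
  apply: (@le_trans _ _ (expR (- (eps ^+ 2 / 8)) ^+ k)).
    by rewrite lerXn2r ?nnegrE ?expR_ge0 // expR_ge1Dx.
  rewrite -expRM_natl ler_expR mulrN lerN2.
  have e2 : 0 < eps ^+ 2 by rewrite exprn_gt0.
  by move: hk; rewrite mulrA ler_pdivrMr // => hk; lra.
by rewrite -ler_pdivlMr // ltr0n ltnW.
Qed.

(** No query is made when there is a single profile (no voters), a single candidate, or a void
    promise ([eps > 1]). *)
Definition winner_algorithm (R : realType) (n m : nat) :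
    (profile n m -> 'I_m) -> R -> R -> algorithm n m :=
  match n return (profile n m -> 'I_m) -> R -> R -> algorithm n m with
  | 0 => fun w eps delta => Output _ (w (empty_profile _ m))
  | n'.+1 => fun w eps delta =>
    if (1 < m)%N && (eps <= 1) then
      if eps * n'.+1%:R <= 1 then query_all w (enum 'I_n'.+1) (empty_profile _ m)
      else sampling n' (w (empty_profile _ m))
             (Num.trunc (10 * (ln (m%:R / delta) / eps ^+ 2))) [::]
    else Output _ (w (empty_profile _ m))
  end.

Theorem theorem5 (R : realType) :
  exists (C : R)
         (A : forall n m : nat,
              (profile n m -> 'I_m) -> R -> R -> algorithm n m),
    0 < C /\
    forall (n m : nat) (w : profile n m -> 'I_m) (eps delta : R),
      approval_rule w ->
      0 < eps ->
      0 < delta -> delta < 1 ->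
      solves_winner_determination w eps delta (A n m w eps delta) /\
      forall P : profile n m,
        (num_queries (A n m w eps delta) P)%:R
          <= C * (ln (m%:R / delta) / eps ^+ 2).

Proof.
exists 10, (@winner_algorithm R); split=> // -[|n] m w eps delta wR e0 d0 d1.
  split=> [P _|P] /=.
    rewrite (_ : empty_profile 0 m = P) ?eqxx; last by apply/ffunP => -[].
    by rewrite gerBl ltW.
  have m0 : (0 < m)%N by apply: leq_ltn_trans (ltn_ord (w P)).
  rewrite mulr_ge0 // divr_ge0 ?exprn_ge0 ?(ltW e0) // ln_ge0 //.
  rewrite ler_pdivlMr // mul1r (le_trans (ltW d1)) // ler1n //.
have m0 : (0 < m)%N by apply: leq_ltn_trans (ltn_ord (w (empty_profile _ m))).
have ln0 : 0 <= ln (m%:R / delta).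
  by rewrite ln_ge0 // ler_pdivlMr // mul1r (le_trans (ltW d1)) // ler1n.
have e2 : 0 < eps ^+ 2 by rewrite exprn_gt0.
have bound_ge0 : 0 <= 10 * (ln (m%:R / delta) / eps ^+ 2).
  by rewrite mulr_ge0 // divr_ge0 // ltW.
rewrite /winner_algorithm /solves_winner_determination.
have [m1|m1] /= := ltnP 1 m; last first.
  split=> // P _.
  rewrite (_ : (_ == w P) = true) ?gerBl ?ltW //.
  by apply/eqP/val_inj; case: (w P) (w (empty_profile _ m)) => i + [j] /=; lia.
have [e1|e1] /= := leP eps 1; last first.
  split=> // P epsP.
  have := margin_of_victory_le wR epsP (ltn0Sn n) m1.
  by rewrite ger_pMl ?ltr0n // leNgt e1.
have L := ln_ratio_ge_half m1 d0 d1.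
have [en|en] := leP (eps * n.+1%:R) 1.
  split=> P => [_|].
    rewrite output_prob_query_all ?eqxx ?gerBl ?ltW // => i.
    by rewrite mem_enum.
  rewrite num_queries_query_all size_enum_ord mulrA ler_pdivlMr //.
  (* Here [n.+1 * eps^2 <= eps <= 1], while [10 * ln (m / delta) >= 5]. *)
  rewrite expr2 mulrA; nra.
split=> P => [epsP|].
  apply: (sampling_solves (eps := eps)) => //; first by rewrite e0.
  (* Truncating [10 * q] loses less than 1, and [q >= 1/2] gives [10 * q - 1 >= 8 * q]: hence 10
     instead of 8. *)
  have /andP[_] := truncn_itv bound_ge0; rewrite -[ltRHS]natr1.
  set q := _ / _; set k := (Num.trunc _)%:R.
  have : 1 / 2 <= ln (m%:R / delta) / eps ^+ 2.
    by rewrite ler_pdivlMr //; apply: le_trans L; nra.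
  rewrite -/q; clearbody k q; lra.
apply: le_trans (_ : (Num.trunc (10 * (ln (m%:R / delta) / eps ^+ 2)))%:R <= _).
  by rewrite ler_nat num_queries_sampling.
by rewrite truncn_le.
Qed.
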